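(* Let $k\in\{3,4\}$, let $G$ be a group, let $G_1,\ldots,G_k$ be subgroups of $G$ with $[G:G_i]<\infty$ for all $i=1,\ldots,k$, and let $a_1,\ldots,a_k\in G$ be such that the left cosets $a_1G_1,\ldots,a_kG_k$ are pairwise disjoint. Then there exist $i,j$ with $1\le i<j\le k$ such that $\gcd([G:G_i],[G:G_j])\ge k$.
   Context: For a subgroup $H$ of a (multiplicative) group $G$ and $a\in G$, the left coset is $aH=\{ah: h\in H\}$, and $[G:H]$ denotes the index of $H$ in $G$, i.e. the cardinality of the set $G/H=\{aH: a\in G\}$ of left cosets. The group $G$ is not assumed to be finite or abelian. *)

(* Defs.v *)
From mathcomp Require Import all_boot.
From mathcomp Require Import finmap.
From mathcomp Require Import boolp classical_sets functions cardinality.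

Set Implicit Arguments.
Unset Strict Implicit.
Unset Printing Implicit Defensive.

Local Open Scope classical_set_scope.

(* [groupType] covers arbitrary, possibly infinite and non-commutative groups;
   its choiceType structure is no restriction, since [boolp] provides one on
   every type. Likewise a [set G] has a Boolean membership test by [boolp]. *)
Definition is_subgroup (G : groupType) (H : set G) : Prop :=
  group_closed [in H].

Definition left_coset (G : groupType) (a : G) (H : set G) : set G :=
  [set (a * h)%g | h in H].

Definition left_cosets (G : groupType) (H : set G) : set (set G) :=
  [set left_coset a H | a in [set: G]].

Definition finite_index (G : groupType) (H : set G) : Prop :=
  finite_set (left_cosets H).

(* Meaningful only under [finite_index H]: [fset_set] of an infinite set is
   empty, so the value is 0 when the index is infinite. *)
Definition subgroup_index (G : groupType) (H : set G) : nat :=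
  #|` fset_set (left_cosets H)|%fset.

(* Main.v *)
Require Import Defs.
From mathcomp Require Import all_boot.
From mathcomp Require Import finmap.
From mathcomp Require Import boolp classical_sets functions cardinality.
From mathcomp Require Import zify.

(** Let [G] act by left translation on the finite set [T] of all the cosets
    involved, and put [o i = H i] and [p i = a i H i]. The orbit of [o i] has
    [n i] points, where [n i] is the index of [H i], it contains [p i], and
    disjointness of the cosets says that no single element of [G] carries
    [(o i, o j)] to [(p i, p j)]. So the theorem becomes a counting problem
    about [G]-invariant subsets of products of transitive [G]-sets, and all
    the counting is of one kind: an invariant subset of [X * Y], with [X]
    transitive, has equally many points over each point of [X]; in particular
    its size is divisible by the size of [X].

    Since the orbit of [(o i, o j)] has size divisible by [n i] and [n j], it
    fills a proportion [d / gcd (n i, n j)] of the product of the two orbits,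
    for some positive integer [d]; the same holds for [(p i, p j)]. These two
    pair orbits being disjoint, all gcds are at least 2. If all gcds are less
    than [k], elementary arithmetic leaves only two situations: some three
    indices have all gcds equal to 2, or [k = 4] and all gcds equal 3. Write
    [q] for the common gcd and call a pair orbit thin if its proportion is
    [1/q].

    The key fact ([thin_link_trans]) concerns three points with common gcd [q]
    and thin pair orbits: membership in these orbits is transitive, as for
    cosets of a common subgroup of index [q]. Therefore, if [q + 1] indices
    have thin pair orbits [(o i, o j)], we fix one index [z] among them: the
    [q] sets of points linked to the [p i], [i <> z], are disjoint and each of
    proportion [1/q], so they cover the orbit of [p z], although none contains
    [p z] ([not_all_thin]). When [q = 2] all pair orbits are thin, and this is
    already a contradiction.

    When [q = 3] a pair orbit may be fat, of proportion [2/3]. The orbit of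
    [(o i, o j)] and that of [(p i, p j)] cannot both be fat, and by the
    preceding argument, used for [o] and for [p], there is a fat pair of each
    kind. What excludes this is parity ([fat_parity]): over a fat orbit
    certain fibres have proportion [1/6], which forces [6] to divide some
    [n l], and this can happen for one [l] only since the gcds are 3. If a fat
    pair of [o] and one of [p] share an index, parity applies to two different
    indices ([fat_not_adjacent]). Otherwise, the four indices form a fat pair
    of [o] and a fat pair of [p], all other pairs are thin, and parity applies
    to both indices of the second pair ([fat_dvd6]). *)

Set Implicit Arguments.
Unset Strict Implicit.
Unset Printing Implicit Defensive.

(** * Arithmetic and counting *)

Lemma gcd3_not_both6 (a b : nat) : gcdn a b = 3 -> 6 %| a -> ~~ (6 %| b).
Proof.
move=> g3 d6a; apply/negP => d6b.
have : 6 %| gcdn a b by rewrite dvdn_gcd d6a d6b.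
by rewrite g3.
Qed.

(** If [gcd a c] were 3 then [6] would divide [a]; so [b], prime to 3, and [c],
    odd, could have neither 2 nor 3 as gcd. *)
Lemma gcd_triple_eq2 (a b c : nat) :
  gcdn a b = 2 -> gcdn a c \in [:: 2; 3] -> gcdn b c \in [:: 2; 3] ->
  gcdn a c = 2.
Proof.
move=> gab; rewrite !inE => /orP[/eqP //|/eqP gac] gbc.
have d3a : 3 %| a by rewrite -gac dvdn_gcdl.
have d2a : 2 %| a by rewrite -gab dvdn_gcdl.
case/orP: gbc => /eqP gbc.
  have : 2 %| gcdn a c by rewrite dvdn_gcd d2a -gbc dvdn_gcdr.
  by rewrite gac.
have : 3 %| gcdn a b by rewrite dvdn_gcd d3a -gbc dvdn_gcdl.
by rewrite gab.
Qed.

Lemma sum_card_disjoint (I T : finType) (A : {set I}) (F : I -> {set T})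
    (S : {set T}) :
  (forall i, i \in A -> F i \subset S) ->
  (forall i j x, i \in A -> j \in A -> x \in F i -> x \in F j -> i = j) ->
  \sum_(i in A) #|F i| <= #|S|.
Proof.
move=> sub disj; under eq_bigr do rewrite -sum1_card.
rewrite (exchange_big_dep (mem S)) /=; last first.
  by move=> i x iA; exact/fintype.subsetP/sub.
rewrite -sum1_card; apply: leq_sum => x _; rewrite sum1dep_card.
apply/card_le1_eqP => i j; rewrite !inE => /andP[iA xi] /andP[jA xj].
exact: disj jA iA xj xi.
Qed.

(** * Group actions and fibre counting *)

Section Actions.
Variable G : groupType.

Definition is_action (U : finType) (f : G -> U -> U) : Prop :=
  (forall u, f 1%g u = u) /\ (forall g h u, f (g * h)%g u = f g (f h u)).

Definition orb (U : finType) (f : G -> U -> U) (u : U) : {set U} :=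
  [set v | `[< exists g, f g u = v >]]%SET.

Definition diag (U V : finType) (f : G -> U -> U) (f' : G -> V -> V) :
    G -> U * V -> U * V :=
  fun g p => (f g p.1, f' g p.2).

Section OneAction.
Variables (U : finType) (f : G -> U -> U).
Hypothesis actf : is_action f.

Lemma actK g : cancel (f g) (f g^-1%g).
Proof. by case: actf => f1 fM u; rewrite -fM mulVg f1. Qed.

Lemma actVK g : cancel (f g^-1%g) (f g).
Proof. by case: actf => f1 fM u; rewrite -fM mulgV f1. Qed.

Lemma orbP u v : reflect (exists g, f g u = v) (v \in orb f u).
Proof. by rewrite inE; exact: asboolP. Qed.

Lemma mem_orb g u : f g u \in orb f u.
Proof. by apply/orbP; exists g. Qed.

Lemma orb_refl u : u \in orb f u.
Proof. by apply/orbP; exists 1%g; case: actf. Qed.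

Lemma orb_eq u v : v \in orb f u -> orb f v = orb f u.
Proof.
case: (actf) => f1 fM /orbP[g <-]; apply/setP => w.
apply/orbP/orbP => -[h <-]; first by exists (h * g)%g; rewrite fM.
by exists (h * g^-1)%g; rewrite fM actK.
Qed.

End OneAction.

Lemma diag_action (U V : finType) (f : G -> U -> U) (f' : G -> V -> V) :
  is_action f -> is_action f' -> is_action (diag f f').
Proof.
move=> [f1 fM] [f1' fM']; split=> [[u v]|g h [u v]]; rewrite /diag /=.
  by rewrite f1 f1'.
by rewrite fM fM'.
Qed.

(** Translating by [g] maps the fibre over [u] bijectively to the fibre over
    [f g u]. *)
Lemma card_fibration (U V : finType) (f : G -> U -> U) (f' : G -> V -> V)
    (D : {set U * V}) (u : U) :
  is_action f -> is_action f' ->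
  (forall g p, p \in D -> diag f f' g p \in D) ->
  (forall p, p \in D -> p.1 \in orb f u) ->
  #|D| = #|orb f u| * #|[set v | (u, v) \in D]%SET|.
Proof.
move=> actf actf' invD subD.
rewrite -sum1_card (partition_big fst (mem (orb f u))) //=.
rewrite -sum_nat_const; apply: eq_bigr => _ /orbP[g <-].
rewrite sum1dep_card.
have inj_gv : injective (fun v => (f g u, f' g v)).
  by move=> v w [/(can_inj (actK actf' g))].
rewrite -(card_imset _ inj_gv); apply: eq_card => -[x y].
rewrite inE /=; apply/andP/imsetP => [[Dxy /eqP xE]|[v]].
  exists (f' g^-1%g y); last by rewrite (actVK actf') xE.
  by rewrite inE; move: (invD g^-1%g _ Dxy); rewrite /diag /= xE (actK actf).
by rewrite inE => /(invD g) ? [-> ->].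
Qed.

Lemma card_fibration_right (U V : finType) (f : G -> U -> U)
    (f' : G -> V -> V) (D : {set U * V}) (v : V) :
  is_action f -> is_action f' ->
  (forall g p, p \in D -> diag f f' g p \in D) ->
  (forall p, p \in D -> p.2 \in orb f' v) ->
  #|D| = #|orb f' v| * #|[set u | (u, v) \in D]%SET|.
Proof.
move=> actf actf' invD subD.
have swapI : injective (fun p : U * V => (p.2, p.1)) by move=> [? ?] [? ?] [-> ->].
rewrite -(card_imset _ swapI) (@card_fibration _ _ f' f _ v) //.
- congr (_ * _); apply: eq_card => u; rewrite !inE.
  apply/imsetP/idP => [[[? ?] ? [-> ->]]//|Duv].
  by exists (u, v).
- by move=> g _ /imsetP[p /(invD g) Dp ->]; apply/imsetP; exists (diag f f' g p).
- by move=> _ /imsetP[p Dp ->] /=; exact: subD.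
Qed.

End Actions.

(** * Orbits of pairs *)

Section Pairs.
Variables (G : groupType) (T : finType) (act : G -> T -> T).
Hypothesis actT : is_action act.

Local Notation orbit := (orb act).
Local Notation pact := (diag act act).

Definition orbit_card (a : T) := #|orbit a|.
Local Notation n := orbit_card.

(** The pair [(x, y)] lies in the diagonal orbit of [(a, b)]. For [a = H] and
    [b = K], subgroups, the orbits of such pairs correspond to the double
    cosets of [H] and [K]. *)
Definition link (a b x y : T) : bool := (x, y) \in orb pact (a, b).

Definition pair_card (a b : T) := #|orb pact (a, b)|.
Local Notation N := pair_card.

(** The orbit of [(a, b)] has proportion [1/q] in the product of the orbits of
    [a] and [b], or [2/3] for [fat]. Stated as products to avoid division. *)
Definition thin (q : nat) (a b : T) := q * N a b = n a * n b.

Definition fat (a b : T) := 3 * N a b = 2 * (n a * n b).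

Let pactT : is_action pact := diag_action actT actT.

Lemma linkP a b x y :
  reflect (exists g, act g a = x /\ act g b = y) (link a b x y).
Proof.
by apply: (iffP (orbP _ _ _)) => -[g] => [[<- <-]|[<- <-]]; exists g.
Qed.

Lemma link_refl a b : link a b a b.
Proof. exact: orb_refl. Qed.

Lemma link_swap a b x y : link a b x y = link b a y x.
Proof. by apply/linkP/linkP => -[g [? ?]]; exists g. Qed.

Lemma link_act g a b x y : link a b (act g x) (act g y) = link a b x y.
Proof.
rewrite /link; have := @mem_orb _ _ pact g (x, y).
rewrite -[pact g _]/(act g x, act g y) => orb_xy.
by apply/idP/idP=> /(orb_eq pactT) <-; rewrite ?(orb_eq pactT orb_xy) // orb_refl.
Qed.

Lemma link_rebase a b x y : link a b x y -> link x y =2 link a b.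
Proof. by move=> /(orb_eq pactT) E u v; rewrite /link E. Qed.

Lemma link_orbit a b x y :
  link a b x y -> (x \in orbit a) * (y \in orbit b).
Proof. by move=> /linkP[g [<- <-]]; split; apply: mem_orb. Qed.

Lemma orbit_card_gt0 a : 0 < n a.
Proof. by apply/card_gt0P; exists a; exact: orb_refl. Qed.

Lemma orbit_card_eq a b : b \in orbit a -> n b = n a.
Proof. by rewrite /n => /(orb_eq actT) ->. Qed.

Lemma pair_card_eq a b x y : link a b x y -> N x y = N a b.
Proof. by rewrite /N => /(orb_eq pactT) ->. Qed.

Lemma pair_cardl a b : N a b = n a * #|[set y | link a b a y]%SET|.
Proof.
rewrite /N (@card_fibration _ _ _ act act _ a) //.
  by move=> g [x y]; rewrite -!/(link _ _ _ _) link_act.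
by move=> [x y] /link_orbit[].
Qed.

Lemma pair_cardr a b : N a b = n b * #|[set x | link a b x b]%SET|.
Proof.
rewrite /N (@card_fibration_right _ _ _ act act _ b) //.
  by move=> g [x y]; rewrite -!/(link _ _ _ _) link_act.
by move=> [x y] /link_orbit[].
Qed.

Lemma pair_cardC a b : N a b = N b a.
Proof.
rewrite pair_cardl pair_cardr; congr (_ * _); apply: eq_card => y.
by rewrite !inE link_swap.
Qed.

Lemma thinC q a b : thin q a b -> thin q b a.
Proof. by rewrite /thin pair_cardC mulnC => ->; rewrite mulnC. Qed.

Lemma fatC a b : fat a b -> fat b a.
Proof. by rewrite /fat pair_cardC [n b * _]mulnC. Qed.

Lemma thin_rebase q a b x y : link a b x y -> thin q a b -> thin q x y.
Proof.
move=> L; rewrite /thin (pair_card_eq L).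
by rewrite !(orbit_card_eq (link_orbit L).1, orbit_card_eq (link_orbit L).2).
Qed.

Lemma thin_fiber q a b x : thin q a b -> x \in orbit a ->
  q * #|[set y | link a b x y]%SET| = n b.
Proof.
move=> thin_ab /orbP[g gx].
have L : link a b x (act g b) by apply/linkP; exists g.
have := thin_rebase L thin_ab.
rewrite /thin pair_cardl (orbit_card_eq (link_orbit L).2) mulnCA => /eqP.
rewrite eqn_pmul2l ?orbit_card_gt0 // => /eqP <-; congr (_ * _).
by apply: eq_card => y; rewrite !inE (link_rebase L).
Qed.

(** Both orbit sizes divide the size of the pair orbit, hence so does their
    least common multiple, which has proportion [1 / gcd]. *)
Lemma pair_weight a b :
  exists2 d, 0 < d & gcdn (n a) (n b) * N a b = d * (n a * n b).
Proof.
have : lcmn (n a) (n b) %| N a b.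
  by rewrite dvdn_lcm {1}pair_cardl pair_cardr !dvdn_mulr.
move=> /dvdnP[d Nd]; exists d; last first.
  by rewrite Nd mulnCA [gcdn _ _ * _]mulnC muln_lcm_gcd.
rewrite lt0n; apply: contra_eqN Nd => /eqP ->.
by rewrite mul0n -lt0n; apply/card_gt0P; exists (a, b); exact: orb_refl.
Qed.

(** Over the thin orbit of [(a, b)], count the triples whose three pairs are all
    linked: with [n a = q * ma], [n b = q * mb] and [n c = q * mc], the number
    is [q * ma * mb * e], where [e] is the size of a fibre, and it is divisible
    by [n c]. As [mc] is prime to [ma * mb], it divides [e]. But the fibre over
    [(a, b)] contains [c], and every fibre lies in a set of [mc] points linked
    to the second coordinate. So each fibre is the whole of that set. *)
Lemma thin_link_trans q a b c x y z : 0 < q ->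
  gcdn (n a) (n b) = q -> gcdn (n a) (n c) = q -> gcdn (n b) (n c) = q ->
  thin q a b -> thin q a c -> thin q b c ->
  link a b x y -> link b c y z -> link a c x z.
Proof.
move=> q_gt0 gab gac gbc tab tac tbc Lab Lbc.
pose E := [set p : (T * T) * T |
  [&& link a b p.1.1 p.1.2, link a c p.1.1 p.2 & link b c p.1.2 p.2]]%SET.
have invE g p : p \in E -> diag pact act g p \in E.
  by rewrite !inE /= !link_act.
have cardE1 : #|E| = N a b * #|[set w | ((a, b), w) \in E]%SET|.
  apply: (card_fibration pactT actT invE) => -[[u v] w].
  by rewrite inE => /and3P[].
have cardE2 : #|E| = N a b * #|[set w | ((x, y), w) \in E]%SET|.
  rewrite -(pair_card_eq Lab).
  apply: (card_fibration pactT actT invE) => -[[u v] w].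
  by rewrite inE => /and3P[/= + _ _]; rewrite -(link_rebase Lab).
have cardE3 : #|E| = n c * #|[set u | (u, c) \in E]%SET|.
  apply: (card_fibration_right pactT actT invE) => -[[u v] w].
  by rewrite inE => /and3P[/= _ /link_orbit[]].
set e := #|[set w | ((a, b), w) \in E]%SET| in cardE1.
set e2 := #|[set w | ((x, y), w) \in E]%SET| in cardE2.
set e3 := #|[set u | (u, c) \in E]%SET| in cardE3.
have e_gt0 : 0 < e.
  by apply/card_gt0P; exists c; rewrite !inE /= !link_refl.
have N_gt0 : 0 < N a b by apply/card_gt0P; exists (a, b); exact: orb_refl.
have e2E : e2 = e by apply/eqP; rewrite -(eqn_pmul2l N_gt0) -cardE1 -cardE2.
have dqa : q %| n a by rewrite -gab dvdn_gcdl.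
have dqb : q %| n b by rewrite -gab dvdn_gcdr.
have dqc : q %| n c by rewrite -gac dvdn_gcdr.
pose ma := n a %/ q; pose mb := n b %/ q; pose mc := n c %/ q.
have naE : n a = q * ma by rewrite mulnC divnK.
have nbE : n b = q * mb by rewrite mulnC divnK.
have ncE : n c = q * mc by rewrite mulnC divnK.
have dvd_e : mc %| e.
  have cop m m' k k' : k = q * m -> k' = q * m' -> gcdn k k' = q -> coprime m' m.
    move=> -> ->; rewrite -muln_gcdr -{2}[q]muln1 => /eqP.
    by rewrite eqn_pmul2l // /coprime gcdnC.
  rewrite -(@Gauss_dvdr _ (ma * mb)); last first.
    by rewrite coprimeMr (cop _ _ _ _ naE ncE gac) (cop _ _ _ _ nbE ncE gbc).
  apply/dvdnP; exists e3; apply/eqP.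
  rewrite -(eqn_pmul2l q_gt0) -(eqn_pmul2l q_gt0); apply/eqP.
  (* two expressions of [q * #|E|], by fibres over [(a, b)] and over [c] *)
  have : q * #|E| = q * #|E| by [].
  rewrite {1}cardE1 cardE3 mulnA tab naE nbE ncE; lia.
have xa := (link_orbit Lab).1; have yb := (link_orbit Lab).2.
have := thin_fiber tac xa; have := thin_fiber tbc yb.
set Fx := [set z | link a c x z]%SET; set Fy := [set z | link b c y z]%SET.
rewrite ncE => /eqP; rewrite eqn_pmul2l // => /eqP cFy /eqP.
rewrite eqn_pmul2l // => /eqP cFx.
have e2I : e2 = #|Fy :&: Fx|.
  by apply: eq_card => w; rewrite !inE /= Lab /= andbC.
have : Fy :&: Fx == Fy.
  by rewrite eqEcard subsetIl cFy -e2I e2E; apply: dvdn_leq.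
by move=> /eqP/setP/(_ z); rewrite !inE Lbc.
Qed.

(** Count the triples [(x, y, z)] with [(x, z)] and [(y, z)] in the two given
    thin orbits. Over [z], one third of the [x] and one third of the [y]
    qualify, which is proportion [1/9] in all. By hypothesis these triples lie
    over the fat orbit of [(a, b)], of proportion [2/3], so that each of its
    fibres consists of exactly one sixth of the orbit of [c]. *)
Lemma fat_parity a b a' c b' c' :
  a' \in orbit a -> b' \in orbit b -> c' \in orbit c ->
  fat a b -> thin 3 a' c -> thin 3 b' c' ->
  (forall x y z, link a' c x z -> link b' c' y z -> link a b x y) ->
  6 %| n c.
Proof.
move=> a'a b'b c'c fab tac tbc sub.
pose E := [set p : (T * T) * T |
  link a' c p.1.1 p.2 && link b' c' p.1.2 p.2]%SET.
have invE g p : p \in E -> diag pact act g p \in E.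
  by rewrite !inE /= !link_act.
have cardE1 : #|E| = N a b * #|[set w | ((a, b), w) \in E]%SET|.
  apply: (card_fibration pactT actT invE) => -[[x y] z].
  by rewrite inE => /andP[/= + +]; exact: sub.
have cardE2 : #|E| = n c * #|[set u | (u, c) \in E]%SET|.
  apply: (card_fibration_right pactT actT invE) => -[[u v] w].
  by rewrite inE => /andP[/= /link_orbit[]].
have cc' : c \in orbit c' by rewrite (orb_eq actT c'c) orb_refl.
have fa := thin_fiber (thinC tac) (orb_refl actT c).
have fb := thin_fiber (thinC tbc) cc'.
rewrite (orbit_card_eq a'a) in fa; rewrite (orbit_card_eq b'b) in fb.
have prodE : #|[set u | (u, c) \in E]%SET| =
    #|[set x | link c a' c x]%SET| * #|[set y | link c' b' c y]%SET|.
  rewrite -cardsX; apply: eq_card => -[x y].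
  by rewrite !inE /= link_swap [link b' _ _ _]link_swap.
apply/dvdnP; exists #|[set w | ((a, b), w) \in E]%SET|.
have na := orbit_card_gt0 a; have nb := orbit_card_gt0 b.
apply/eqP; rewrite -(eqn_pmul2l na) -(eqn_pmul2l nb); apply/eqP.
move: fab; rewrite /fat => fab.
(* two expressions of [9 * #|E|], by fibres over [(a, b)] and over [c] *)
have : 3 * (3 * #|E|) = 3 * (3 * #|E|) by [].
rewrite {1}cardE1 cardE2 prodE -fa -fb; rewrite -fa -fb in fab; nia.
Qed.

(** * Opposed families *)

Variables (I : finType).

(** For [o i] a subgroup and [p i] one of its cosets, the second condition says
    that the cosets are pairwise disjoint. Exchanging [o] and [p] preserves the
    relation, which halves the case analysis below. *)
Definition opposed (o p : I -> T) :=
  (forall i, p i \in orbit (o i)) /\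
  (forall i j, i != j -> ~~ link (o i) (o j) (p i) (p j)).

Lemma opposed_sym o p : opposed o p -> opposed p o.
Proof.
move=> [po op]; split=> [i|i j ij].
  by rewrite (orb_eq actT (po i)) orb_refl.
by apply: contra (op _ _ ij) => /link_rebase ->; exact: link_refl.
Qed.

Lemma opposed_card o p : opposed o p -> forall i, n (p i) = n (o i).
Proof. by move=> [po _] i; exact: orbit_card_eq. Qed.

Lemma opposed_link o p i j x y : opposed o p -> i != j ->
  link (o i) (o j) x y -> link (p i) (p j) x y -> False.
Proof.
move=> [_ op] ij Lo Lp; apply/negP: (op _ _ ij).
by rewrite -(link_rebase Lo) (link_rebase Lp) link_refl.
Qed.

Lemma opposed_disjoint o p i j : opposed o p -> i != j ->
  [disjoint orb pact (o i, o j) & orb pact (p i, p j)].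
Proof.
move=> opp ij; apply/pred0P => -[x y] /=; apply/negP => /andP[].
exact: opposed_link.
Qed.

Lemma opposed_sub o p i j : opposed o p ->
  orb pact (o i, o j) :|: orb pact (p i, p j)
    \subset finset.setX (orbit (o i)) (orbit (o j)).
Proof.
move=> [po _]; apply/fintype.subsetP => -[x y] /finset.setUP[] /link_orbit[].
  by rewrite finset.in_setX => -> ->.
by rewrite (orb_eq actT (po i)) (orb_eq actT (po j)) finset.in_setX => -> ->.
Qed.

Lemma opposed_pair_card o p i j : opposed o p -> i != j ->
  N (o i) (o j) + N (p i) (p j) <= n (o i) * n (o j).
Proof.
move=> opp ij; rewrite -cardsX.
have := (leq_card_setU (orb pact (o i, o j)) (orb pact (p i, p j))).2.
by rewrite (opposed_disjoint opp ij) => /eqP <-; exact/subset_leq_card/opposed_sub.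
Qed.

(** The proportions of the two pair orbits are positive multiples of [1 / g]
    with sum at most 1, by disjointness. *)
Lemma opposed_weight o p i j : opposed o p -> i != j ->
  let g := gcdn (n (o i)) (n (o j)) in
  exists d d', [/\ 0 < d, 0 < d', d + d' <= g,
    g * N (o i) (o j) = d * (n (o i) * n (o j)) &
    g * N (p i) (p j) = d' * (n (o i) * n (o j))].
Proof.
move=> opp ij g.
have [d d_gt0 dE] := pair_weight (o i) (o j).
have [d' d'_gt0] := pair_weight (p i) (p j).
rewrite !(opposed_card opp) -/g => d'E.
exists d, d'; split=> //.
have nn_gt0 : 0 < n (o i) * n (o j) by rewrite muln_gt0 !orbit_card_gt0.
rewrite -(leq_pmul2r nn_gt0) mulnDl -dE -d'E -mulnDr leq_mul2l.
by rewrite opposed_pair_card ?orbT.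
Qed.

Lemma opposed_gcd_gt1 o p i j : opposed o p -> i != j ->
  1 < gcdn (n (o i)) (n (o j)).
Proof. by move=> opp /(opposed_weight opp)[d [d' [? ? ? _ _]]]; lia. Qed.

Lemma opposed_thin2 o p i j : opposed o p -> i != j ->
  gcdn (n (o i)) (n (o j)) = 2 -> thin 2 (o i) (o j).
Proof.
move=> opp /(opposed_weight opp)[d [d' [d0 d'0 + + _]]] g2.
rewrite g2 => dd'; have -> : d = 1 by lia.
by rewrite mul1n.
Qed.

Lemma opposed_thin_or_fat o p i j : opposed o p -> i != j ->
  gcdn (n (o i)) (n (o j)) = 3 -> thin 3 (o i) (o j) \/ fat (o i) (o j).
Proof.
move=> opp /(opposed_weight opp)[d [d' [d0 d'0 + + _]]] g3.
rewrite g3 => dd'; have [->|->] : d = 1 \/ d = 2 by lia.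
  by rewrite mul1n; left.
by right.
Qed.

Lemma opposed_fat_thin o p i j : opposed o p -> i != j ->
  gcdn (n (o i)) (n (o j)) = 3 -> fat (o i) (o j) -> thin 3 (p i) (p j).
Proof.
move=> opp /(opposed_weight opp)[d [d' [d0 d'0 + + d'E]]] g3; rewrite /fat.
rewrite /thin !(opposed_card opp) -{2}g3 d'E g3 => dd' -> /eqP.
rewrite eqn_pmul2r ?muln_gt0 ?orbit_card_gt0 // => d2.
by have -> : d' = 1; [lia | rewrite mul1n].
Qed.

(** The orbit of [(p i, p j)] fills the third that the fat orbit leaves. *)
Lemma opposed_fat_cover o p i j x y : opposed o p -> i != j ->
  gcdn (n (o i)) (n (o j)) = 3 -> fat (o i) (o j) ->
  x \in orbit (o i) -> y \in orbit (o j) -> ~~ link (p i) (p j) x y ->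
  link (o i) (o j) x y.
Proof.
move=> opp ij g3 fat_o xo yo; apply: contraNT => not_o.
have := opposed_fat_thin opp ij g3 fat_o.
rewrite /thin !(opposed_card opp) => thin_p.
have cardU : #|orb pact (o i, o j) :|: orb pact (p i, p j)| =
    N (o i) (o j) + N (p i) (p j).
  have := (leq_card_setU (orb pact (o i, o j)) (orb pact (p i, p j))).2.
  by rewrite (opposed_disjoint opp ij) => /eqP.
have : orb pact (o i, o j) :|: orb pact (p i, p j)
    == finset.setX (orbit (o i)) (orbit (o j)).
  rewrite eqEcard opposed_sub // cardU cardsX -!/(n _).
  by move: fat_o; rewrite /fat; lia.
move=> /eqP/setP/(_ (x, y)).
by rewrite finset.in_setU finset.in_setX xo yo -!/(link _ _ _ _) (negbTE not_o).
Qed.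

(** For [i] and [j] other than a fixed [z], a point linked to both [p i] and
    [p j] would put [(p i, p j)] in the orbit of [(o i, o j)], by transitivity. So the [q] sets [F i],
    each one [q]-th of the orbit of [o z], are disjoint and fill that orbit,
    leaving no room for [p z]. *)
Lemma not_all_thin q (A : {set I}) o p : 0 < q -> #|A| = q.+1 ->
  opposed o p ->
  (forall i j, i \in A -> j \in A -> i != j ->
    gcdn (n (o i)) (n (o j)) = q) ->
  ~ (forall i j, i \in A -> j \in A -> i != j -> thin q (o i) (o j)).
Proof.
move=> q_gt0 cardA opp gq thin_o; have [po op] := opp.
have [z zA] : exists z, z \in A by apply/card_gt0P; rewrite cardA.
pose F i := [set x | link (o i) (o z) (p i) x]%SET.
have : \sum_(i in A :\ z) #|F i| <= #|orbit (o z) :\ p z|.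
  apply: sum_card_disjoint => [i|i j x].
    rewrite !inE => /andP[iz iA]; apply/fintype.subsetP => x.
    rewrite [x \in F i]inE => L; rewrite finset.in_setD1 (link_orbit L).2 andbT.
    by apply: contraTneq L => ->; exact: op.
  rewrite !inE => /andP[iz iA] /andP[jz jA] Li.
  rewrite link_swap => Lj; apply/eqP; apply: contraT => ij.
  have /negP[] := op _ _ ij.
  have zj : z != j by rewrite eq_sym.
  by apply: (@thin_link_trans q (o i) (o z) (o j) _ x); rewrite ?gq //;
    exact: thin_o.
rewrite leqNgt => /negP[].
rewrite -(ltn_pmul2l q_gt0) big_distrr /=.
rewrite (eq_bigr (fun=> n (o z))) => [|i]; last first.
  by rewrite !inE => /andP[iz iA]; apply: thin_fiber => //; exact: thin_o.
rewrite sum_nat_const (cardsD1 z) zA in cardA *.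
have -> : #|A :\ z| = q by move: cardA => [].
rewrite ltn_pmul2l // /n [in X in _ < X](cardsD1 (p z)) po.
by rewrite ltnS.
Qed.

Lemma not_all_gcd2 (A : {set I}) o p : #|A| = 3 -> opposed o p ->
  ~ (forall i j, i \in A -> j \in A -> i != j ->
      gcdn (n (o i)) (n (o j)) = 2).
Proof.
move=> cardA opp g2; apply: (not_all_thin _ cardA opp g2) => // i j iA jA ij.
exact: opposed_thin2 opp ij (g2 _ _ iA jA ij).
Qed.

(** Consider triples [(x, y, z)] with [(x, y)] linked as [(p i, p j)], [(x, z)]
    as [(o i, o l)] and [(y, z)] as [(o j, o l)]; these three pair orbits are
    thin. If there is such a triple, transitivity applied to it shows that
    [(o i, o j)] is linked as [(p i, p j)], which is impossible. If there is
    none, the two links at [z] put [(x, y)] in the fat orbit of [(o i, o j)],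
    and the two links at [y] put [(x, z)] in the fat orbit of [(p i, p l)]; by
    parity [6] then divides both [n (o l)] and [n (o j)]. *)
Lemma fat_not_adjacent_thin o p i j l : opposed o p ->
  (forall i j, i != j -> gcdn (n (o i)) (n (o j)) = 3) ->
  i != j -> i != l -> j != l ->
  fat (o i) (o j) -> fat (p i) (p l) -> ~ thin 3 (o j) (o l).
Proof.
move=> opp g3 ij il jl fat_o fat_p thin_o.
have ppo := opposed_sym opp; have [po op] := opp; have [op' _] := ppo.
have g3p i1 i2 : i1 != i2 -> gcdn (n (p i1)) (n (p i2)) = 3.
  by move=> ?; rewrite !(opposed_card opp) g3.
have thin_p_ij := opposed_fat_thin opp ij (g3 _ _ ij) fat_o.
have thin_o_il := opposed_fat_thin ppo il (g3p _ _ il) fat_p.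
have [[x [y [z [Lxy Lxz Lyz]]]]|no_triangle] := pselect (exists x y z,
    [/\ link (p i) (p j) x y, link (o i) (o l) x z & link (o j) (o l) y z]).
  have nx := orbit_card_eq (link_orbit Lxz).1.
  have ny := orbit_card_eq (link_orbit Lyz).1.
  have nz := orbit_card_eq (link_orbit Lyz).2.
  have Lyx : link (p j) (p i) y x by rewrite link_swap.
  have Lzx : link (o l) (o i) z x by rewrite link_swap.
  have : link y x (o j) (o i).
    apply: (@thin_link_trans 3 y z x _ (o l)); rewrite ?nx ?ny ?nz ?g3 //;
      rewrite 1?eq_sym //.
    - exact: thin_rebase Lyz thin_o.
    - exact: thin_rebase Lyx (thinC thin_p_ij).
    - exact: thin_rebase Lzx (thinC thin_o_il).
    - by rewrite (link_rebase Lyz) link_refl.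
    - by rewrite (link_rebase Lzx) link_refl.
  rewrite (link_rebase Lyx) => /(opposed_link opp _); apply.
    by rewrite eq_sym.
  exact: link_refl.
have d6l : 6 %| n (o l).
  apply: (fat_parity _ _ _ fat_o thin_o_il thin_o); rewrite ?orb_refl //.
  move=> x y z Lx Ly; have [xo _] := link_orbit Lx; have [yo _] := link_orbit Ly.
  apply: (opposed_fat_cover opp) => //; first exact: g3.
  by apply/negP => Lp; apply: no_triangle; exists x, y, z.
have lj : l != j by rewrite eq_sym.
have /negP[] := gcd3_not_both6 (g3 _ _ lj) d6l.
rewrite -(opposed_card opp).
apply: (fat_parity _ _ _ fat_p thin_p_ij (thinC thin_o));
  rewrite ?orb_refl ?op' ?po //.
move=> x z y Lx; rewrite link_swap => Lz.
have [xo _] := link_orbit Lx; have [_ zo] := link_orbit Lz.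
apply: (opposed_fat_cover ppo) => //; first exact: g3p.
  by rewrite (orb_eq actT (po l)).
by apply/negP => Lo; apply: no_triangle; exists x, y, z.
Qed.

(** One of [(o j, o l)] and [(p j, p l)] is thin, and the situation is symmetric
    under exchanging [o] with [p] and [j] with [l]. *)
Lemma fat_not_adjacent o p i j l : opposed o p ->
  (forall i j, i != j -> gcdn (n (o i)) (n (o j)) = 3) ->
  i != j -> i != l -> j != l ->
  fat (o i) (o j) -> ~ fat (p i) (p l).
Proof.
move=> opp g3 ij il jl fat_o fat_p.
have g3p i1 i2 : i1 != i2 -> gcdn (n (p i1)) (n (p i2)) = 3.
  by move=> ?; rewrite !(opposed_card opp) g3.
have [thin_o|fat_jl] := opposed_thin_or_fat opp jl (g3 _ _ jl).
  exact: fat_not_adjacent_thin opp g3 ij il jl fat_o fat_p thin_o.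
have thin_p := opposed_fat_thin opp jl (g3 _ _ jl) fat_jl.
apply: (fat_not_adjacent_thin (opposed_sym opp) g3p il ij _ fat_p fat_o).
  by rewrite eq_sym.
exact: thinC.
Qed.

(** Parity, for the orbits of [(o i, o l)] and [(p j, p l)]: if [(x, z)] and
    [(y, z)] lie in these, then [(x, y)] is not linked as [(p i, p j)], since
    transitivity would link [(x, z)] as [(p i, p l)]. *)
Lemma fat_dvd6 o p i j l : opposed o p ->
  (forall i j, i != j -> gcdn (n (o i)) (n (o j)) = 3) ->
  i != j -> i != l -> j != l -> fat (o i) (o j) ->
  thin 3 (o i) (o l) -> thin 3 (p i) (p l) -> thin 3 (p j) (p l) ->
  6 %| n (o l).
Proof.
move=> opp g3 ij il jl fat_o thin_o thin_il thin_jl.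
have [po op] := opp; have [op' _] := opposed_sym opp.
have thin_ij := opposed_fat_thin opp ij (g3 _ _ ij) fat_o.
apply: (fat_parity _ _ _ fat_o thin_o thin_jl); rewrite ?orb_refl ?po //.
move=> x y z Lx Ly; have [xo _] := link_orbit Lx; have [yo _] := link_orbit Ly.
apply: (opposed_fat_cover opp) => //; first exact: g3.
  by rewrite -(orb_eq actT (po j)).
apply/negP => Lp; apply: (opposed_link opp il Lx).
by apply: (@thin_link_trans 3 _ (p j) _ _ y); rewrite ?(opposed_card opp) ?g3.
Qed.

(** Seen as edges between the four indices, the fat pairs of [o] and those of
    [p] are pairwise non-adjacent and both exist, so that they are two opposite
    edges and the other four edges are thin for [o] and for [p]. *)
Lemma not_all_gcd3 o p : #|I| = 4 -> opposed o p ->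
  ~ (forall i j, i != j -> gcdn (n (o i)) (n (o j)) = 3).
Proof.
move=> cardI opp g3; have ppo := opposed_sym opp.
have g3p i1 i2 : i1 != i2 -> gcdn (n (p i1)) (n (p i2)) = 3.
  by move=> ?; rewrite !(opposed_card opp) g3.
have exfat o' p' : opposed o' p' ->
    (forall i j, i != j -> gcdn (n (o' i)) (n (o' j)) = 3) ->
    exists i j, i != j /\ fat (o' i) (o' j).
  move=> opp' g3'; apply: contrapT => no_fat.
  apply: (@not_all_thin 3 [set: I]%SET o' p'); rewrite ?cardsT //.
    by move=> i j _ _; exact: g3'.
  move=> i j _ _ ij; case: (opposed_thin_or_fat opp' ij (g3' _ _ ij)) => // fij.
  by case: no_fat; exists i, j.
have [i [j [ij fat_o]]] := exfat _ _ opp g3.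
have [i' [j' [ij' fat_p]]] := exfat _ _ ppo g3p.
have fat_o' := fatC fat_o; have fat_p' := fatC fat_p.
have not_both u v : u != v -> fat (o u) (o v) -> ~ fat (p u) (p v).
  move=> uv fo fp; have := opposed_fat_thin opp uv (g3 _ _ uv) fo.
  have := orbit_card_gt0 (p u); have := orbit_card_gt0 (p v).
  by move: fp; rewrite /fat /thin; nia.
(* fat edges of [o] and of [p] share no vertex *)
have adj u v w : u != v -> u != w -> fat (o u) (o v) -> ~ fat (p u) (p w).
  move=> uv uw fo; have [<-|vw] := eqVneq v w; first exact: not_both.
  exact: fat_not_adjacent opp g3 uv uw vw fo.
(* hence [i], [j], [i'] and [j'] are distinct *)
have ji : j != i by rewrite eq_sym.
have ji' : j' != i' by rewrite eq_sym.
have ii' : i != i' by apply/eqP => E; apply: (adj i j j'); rewrite // E.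
have ij'n : i != j' by apply/eqP => E; apply: (adj i j i'); rewrite // E.
have ji'n : j != i' by apply/eqP => E; apply: (adj j i j'); rewrite // E.
have jj' : j != j' by apply/eqP => E; apply: (adj j i i'); rewrite // E.
(* An edge between a fat edge of [o] and a fat edge of [p] is adjacent to
   both, so that it is fat for neither. *)
have cross u v : u != v -> (exists w, u != w /\ fat (o u) (o w)) ->
    (exists w, v != w /\ fat (p v) (p w)) ->
    thin 3 (o u) (o v) /\ thin 3 (p u) (p v).
  move=> uv [w [uw fo]] [w' [vw' fp]]; split.
    case: (opposed_thin_or_fat opp uv (g3 _ _ uv)) => // /fatC fuv.
    by case: (adj v u w'); rewrite // eq_sym.
  case: (opposed_thin_or_fat ppo uv (g3p _ _ uv)) => // fuv.
  by case: (adj u w v).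
have [t1 t1'] : thin 3 (o i) (o i') /\ thin 3 (p i) (p i').
  by apply: cross => //; [exists j | exists j'].
have [_ t2] : thin 3 (o j) (o i') /\ thin 3 (p j) (p i').
  by apply: cross => //; [exists i | exists j'].
have [t3 t3'] : thin 3 (o i) (o j') /\ thin 3 (p i) (p j').
  by apply: cross => //; [exists j | exists i'].
have [_ t4] : thin 3 (o j) (o j') /\ thin 3 (p j) (p j').
  by apply: cross => //; [exists i | exists i'].
have /negP[] := gcd3_not_both6 (g3 _ _ ij') (fat_dvd6 opp g3 ij ii' ji'n fat_o t1 t1' t2).
exact: fat_dvd6 opp g3 ij ij'n jj' fat_o t3 t3' t4.
Qed.

Lemma opposed_large_gcd o p : #|I| = 3 \/ #|I| = 4 -> opposed o p ->
  exists i j, i != j /\ #|I| <= gcdn (n (o i)) (n (o j)).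
Proof.
move=> cardI opp; apply: contrapT => no_large.
have small i j : i != j -> 1 < gcdn (n (o i)) (n (o j)) < #|I|.
  move=> ij; rewrite (opposed_gcd_gt1 opp ij) ltnNge /=.
  by apply/negP => ?; apply: no_large; exists i, j.
case: cardI => cardI.
  apply: (@not_all_gcd2 [set: I]%SET o p); rewrite ?cardsT //.
  by move=> i j _ _ /small; rewrite cardI; lia.
apply: (not_all_gcd3 cardI opp) => i j ij.
have gcd23 u v : u != v -> gcdn (n (o u)) (n (o v)) \in [:: 2; 3].
  by move=> /small; rewrite cardI !inE; lia.
have := gcd23 _ _ ij; rewrite !inE => /orP[/eqP gij|/eqP //]; exfalso.
(* a gcd equal to 2 spreads to the triangle with any third index *)
have [l] : exists l, l \in ~: [set i; j]%SET.
  by apply/card_gt0P; have := cardsC [set i; j]%SET; rewrite cards2 cardI ij; lia.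
rewrite !inE negb_or => /andP[li lj].
have il : i != l by rewrite eq_sym.
have jl : j != l by rewrite eq_sym.
have gil := gcd_triple_eq2 gij (gcd23 _ _ il) (gcd23 _ _ jl).
have gjl : gcdn (n (o j)) (n (o l)) = 2.
  by apply: (gcd_triple_eq2 _ (gcd23 _ _ jl) (gcd23 _ _ il)); rewrite gcdnC.
apply: (@not_all_gcd2 [set i; j; l]%SET o p) => //.
  by rewrite -finset.setUA cardsU1 cards2 !inE negb_or ij il jl.
by move=> u v; rewrite !inE => /orP[/orP[]|] /eqP-> /orP[/orP[]|] /eqP->;
  rewrite ?eqxx // gcdnC.
Qed.

End Pairs.

Local Open Scope classical_set_scope.

(** * Cosets as points of a finite action *)

Section Cosets.
Variable G : groupType.

Lemma left_coset1 (A : set G) : left_coset 1%g A = A.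
Proof.
apply/seteqP; split=> [_ [x Ax <-]|x Ax]; first by rewrite mul1g.
by exists x; rewrite // mul1g.
Qed.

Lemma left_cosetM (g h : G) (A : set G) :
  left_coset (g * h)%g A = left_coset g (left_coset h A).
Proof.
apply/seteqP; split=> [_ [x Ax <-]|_ [_ [x Ax <-] <-]].
  by exists (h * x)%g; [exists x | rewrite mulgA].
by exists x; rewrite // mulgA.
Qed.

Lemma mem_left_coset (a : G) (H : set G) : is_subgroup H -> left_coset a H a.
Proof. by move=> [H1 _]; exists 1%g; rewrite ?mulg1 //; exact: set_mem. Qed.

(** Left translation on a finite family of sets; the default value [x] is never
    taken when the family is closed under translation. *)
Definition translate (F : {fset set G}) (g : G) (x : F) : F :=
  insubd x (left_coset g (val x)).

Section Translate.
Variable F : {fset set G}.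
Hypothesis closedF : forall g A, A \in F -> left_coset g A \in F.

Lemma val_translate g (x : F) : val (translate g x) = left_coset g (val x).
Proof. by rewrite insubdK // closedF // fsvalP. Qed.

Lemma translate_action : is_action (@translate F).
Proof.
split=> [x|g h x]; apply: val_inj; rewrite !val_translate.
  exact: left_coset1.
exact: left_cosetM.
Qed.

Lemma card_orb_translate (x : F) :
  finite_index (val x) ->
  #|orb (@translate F) x| = subgroup_index (val x).
Proof.
move=> fin; rewrite cardE -(size_map val); apply/perm_size/uniq_perm.
- by rewrite (map_inj_uniq val_inj) enum_uniq.
- exact: fset_uniq.
move=> A; rewrite in_fset_set //; apply/mapP/idP => [[y]|/set_mem[g _ <-]].
  rewrite mem_enum => /orbP[g <-] ->; rewrite val_translate.
  by apply/mem_set; exists g.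
by exists (translate g x); rewrite ?val_translate // mem_enum mem_orb.
Qed.

End Translate.
End Cosets.

Theorem theorem1p1 (k : nat) (hk : k = 3 \/ k = 4) (G : groupType)
  (H : 'I_k -> set G) (a : 'I_k -> G)
  (subgroupH : forall i, is_subgroup (H i))
  (finiteH : forall i, finite_index (H i))
  (disjH : trivIset [set: 'I_k] (fun i => left_coset (a i) (H i))) :
  exists i j : 'I_k,
    (i < j)%N /\ (k <= gcdn (subgroup_index (H i)) (subgroup_index (H j)))%N.
Proof.
pose F := fset_set (\bigcup_(i in [set: 'I_k]) left_cosets (H i)).
have finU : finite_set (\bigcup_(i in [set: 'I_k]) left_cosets (H i)).
  by apply: bigcup_finite => // i _; exact: finiteH.
have memF A : A \in F <-> exists i b, A = left_coset b (H i).
  rewrite in_fset_set //; split=> [/set_mem[i _ [b _ <-]]|[i [b ->]]].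
    by exists i, b.
  by apply/mem_set; exists i => //; exists b.
have closedF g A : A \in F -> left_coset g A \in F.
  by move=> /memF[i [b ->]]; apply/memF; exists i, (g * b)%g; rewrite left_cosetM.
have cosetF i b : left_coset b (H i) \in F by apply/memF; exists i, b.
have HF i : H i \in F by rewrite -[H i]left_coset1.
pose o i : F := [` HF i]%fset; pose p i : F := [` cosetF i (a i)]%fset.
have actF := translate_action closedF.
have opp : opposed (@translate G F) o p.
  split=> [i|i j /eqP ij].
    by apply/orbP; exists (a i); apply: val_inj; rewrite val_translate.
  apply/negP => /linkP[g [/(congr1 val) + /(congr1 val)]].
  rewrite !val_translate //= => gi gj; apply: ij.
  by apply: (disjH i j) => //; exists g; rewrite -gi -gj; split; exact: mem_left_coset.
have nE i : orbit_card (@translate G F) (o i) = subgroup_index (H i).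
  by apply: (card_orb_translate closedF); exact: finiteH.
have := opposed_large_gcd actF _ opp; rewrite card_ord => /(_ hk)[i [j [ij]]].
rewrite !nE => large.
have := ij; rewrite neq_ltn => /orP[lt_ij|lt_ji]; first by exists i, j.
by exists j, i; rewrite gcdnC.
Qed.
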